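(* Let $\mathcal{Q}=(Q_n)_{n\ge 1}$ be a defective adapted cocycle. Assume that $\mathcal{Q}$ has a finite second moment and satisfies the second-moment deviation inequality with respect to the probability measure $\mu$. Then $\frac1n\mathbb{V}^\mu[Q_n]$ has a limit as $n\to\infty$ (denoted $\sigma^2(\mu;\mathcal{Q})$).
   Context: Let $(G,\mathcal{G})$ be a measurable space, $\mu$ a probability measure on $G$, $\Omega=G^{\mathbb{N}^*}$ with $\mathbb{N}^*=\{1,2,\dots\}$, equipped with the product $\sigma$-field and the product measure $\mathbb{P}^\mu=\mu^{\otimes\mathbb{N}^*}$. $\mathbb{E}^\mu$ and $\mathbb{V}^\mu$ denote expectation and variance under $\mathbb{P}^\mu$. $X_n:\Omega\to G$ are the coordinate maps, $\mathcal{F}_n=\sigma(X_1,\dots,X_n)$, and $\theta_n(\omega_1,\omega_2,\dots)=(\omega_{n+1},\omega_{n+2},\dots)$. A defective adapted cocycle is a sequence $\mathcal{Q}=(Q_n)_{n\in\mathbb{N}^*}$ of real-valued maps on $\Omega$ with $Q_n$ measurable with respect to $\mathcal{F}_n$; by convention $Q_0=0$. Its defect is $\Psi_{n,m}(\omega)=Q_{n+m}(\omega)-Q_n(\omega)-Q_m(\theta_n\omega)$, $n,m\in\mathbb{N}$. Finite second moment: $\mathbb{E}^\mu[|Q_1|^2]<\infty$. Second-moment deviation inequality: there is a constant $\tau_2(\mu;\mathcal{Q})<\infty$ with $\mathbb{E}^\mu[|\Psi_{n,m}|^2]\le\tau_2(\mu;\mathcal{Q})$ for all $n,m\in\mathbb{N}$.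 *)

(* Defs.v *)
From HB Require Import structures.
From mathcomp Require Import all_boot all_order all_algebra.
From mathcomp Require Import all_classical all_reals all_analysis.

Set Implicit Arguments.
Unset Strict Implicit.
Unset Printing Implicit Defensive.

Import Order.TTheory GRing.Theory Num.Theory.
Import numFieldNormedType.Exports.

Local Open Scope classical_set_scope.
Local Open Scope ring_scope.

(* Sequences (omega_1, omega_2, ...) are coded as functions on [nat] starting
   at index 0: [w i] is omega_{i+1}, so [coord i] is the coordinate map
   X_{i+1}. *)
Definition coord (G : Type) (i : nat) (w : nat -> G) : G := w i.

Definition shift (G : Type) (n : nat) (w : nat -> G) : nat -> G :=
  fun k => w (n + k)%N.

(* The sequence space with its product sigma-field: the least one making all
   the coordinate maps measurable. *)
Definition cylinders d (G : measurableType d) : set (set (nat -> G)) :=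
  \bigcup_i preimage_set_system setT (@coord G i) measurable.

Notation Omega G := (g_sigma_algebraType (@cylinders _ G)).

(* F_n = sigma(X_1, ..., X_n); trivial for n = 0. *)
Definition coord_filtration d (G : measurableType d) (n : nat) :
    set (set (nat -> G)) :=
  g_sigma_preimage (fun i : 'I_n => @coord G i).

(* Finite measurable rectangles form a pi-system generating the product
   sigma-field, so for a given mu at most one P satisfies this predicate. *)
Definition is_product_measure d (G : measurableType d) (R : realType)
    (mu : probability G R) (P : probability (Omega G) R) : Prop :=
  forall (n : nat) (A : nat -> set G), (forall i, measurable (A i)) ->
    P [set w | forall i, (i < n)%N -> A i (coord i w)] =
    (\prod_(i < n) mu (A i))%E.

(* Only the terms of index n >= 1 form the cocycle; Q 0 = 0 is a convention. *)
Definition defective_adapted_cocycle d (G : measurableType d) (R : realType)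
    (Q : nat -> Omega G -> R) : Prop :=
  (forall w, Q 0%N w = 0) /\
  (forall n, (0 < n)%N -> forall B : set R, measurable B ->
     coord_filtration n (Q n @^-1` B)).

Definition defect d (G : measurableType d) (R : realType)
    (Q : nat -> Omega G -> R) (n m : nat) (w : Omega G) : R :=
  Q (n + m)%N w - Q n w - Q m (shift n w).

Definition finite_second_moment d (G : measurableType d) (R : realType)
    (P : probability (Omega G) R) (Q : nat -> Omega G -> R) : Prop :=
  ('E_P[fun w => (`|Q 1%N w| ^+ 2)%R] < +oo)%E.

Definition second_moment_deviation d (G : measurableType d) (R : realType)
    (P : probability (Omega G) R) (Q : nat -> Omega G -> R) : Prop :=
  exists tau2 : R, forall n m : nat,
    ('E_P[fun w => (`|defect Q n m w| ^+ 2)%R] <= tau2%:E)%E.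

(* Main.v *)
(* Let s_n be the standard deviation of Q_n. Since Q_n depends only on the first
   n coordinates, it is independent of Q_m \o theta_n, which has the law of Q_m;
   Minkowski's inequality in L^2 then gives
     | s_{n+m} - sqrt (s_n^2 + s_m^2) | <= c   with c = sqrt tau_2.
   A Hyers-Ulam argument concludes: L_n = lim_j 2^{-j/2} s_{2^j n} exists and
   stays at bounded distance from s_n, and dividing the inequality at
   (2^j n, 2^j m) by 2^{j/2} makes n |-> L_n^2 exactly additive. Hence
   s_n = sqrt n L_1 + O(1), so that s_n^2 / n tends to L_1^2. *)
Require Import Defs.
From mathcomp Require Import all_boot all_order all_algebra.
From mathcomp Require Import all_classical all_reals all_analysis.
From mathcomp Require Import measurable_realfun ring.
Set Implicit Arguments.
Unset Strict Implicit.

Import Order.TTheory GRing.Theory Num.Theory.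
Import numFieldNormedType.Exports.
(* [Defs.coord] would otherwise be shadowed by the coordinate function of
   [mathcomp.algebra.vector]. *)
Import Defs.
Local Open Scope classical_set_scope.
Local Open Scope ring_scope.

(** * Hyers-Ulam stability of the Pythagorean equation for real sequences *)

Section approximately_pythagorean.
Context (R : realType) (s : nat -> R) (c : R).
Context (s_ge0 : forall n, 0 <= s n).
Context (s_pyth : forall n m,
  `|s (n + m)%N - Num.sqrt (s n ^+ 2 + s m ^+ 2)| <= c).

Let r : R := (Num.sqrt 2)^-1.
(* [K] is the sum of the errors [r ^+ j.+1 * c] of [u_step] over all [j]. *)
Let K : R := r / (1 - r) * c.
Let u (n j : nat) : R := r ^+ j * s (2 ^ j * n)%N.

Let r_gt0 : 0 < r. Proof. by rewrite invr_gt0 sqrtr_gt0. Qed.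

Let r2 : r * Num.sqrt 2 = 1.
Proof. by rewrite mulVf// gt_eqF// sqrtr_gt0. Qed.

Let r_lt1 : r < 1.
Proof. by rewrite invf_lt1 ?sqrtr_gt0// -[ltLHS]sqrtr1 ltr_sqrt ?ltr1n. Qed.

Let c_ge0 : 0 <= c. Proof. exact: le_trans (normr_ge0 _) (s_pyth 0 0). Qed.

Let K_ge0 : 0 <= K.
Proof. by rewrite mulr_ge0// divr_ge0 ?(ltW r_gt0)// subr_ge0 ltW. Qed.

(** [K] is the fixed point of [x |-> r * (x + c)]; this closes the telescoping estimates below. *)
Let KrB : K - r * K = r * c.
Proof.
by rewrite -{1}[K]mul1r -mulrBl /K mulrA mulrCA divff ?mulr1// subr_eq0 gt_eqF.
Qed.

(** This is [s_pyth] on the diagonal: the square root becomes [Num.sqrt 2 * s (2 ^ j * n)], and [r]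
    cancels the factor [Num.sqrt 2]. *)
Let u_step n j : `|u n j.+1 - u n j| <= r ^+ j.+1 * c.
Proof.
have -> : u n j.+1 - u n j =
    r ^+ j.+1 * (s (2 ^ j.+1 * n)%N - Num.sqrt 2 * s (2 ^ j * n)%N).
  by rewrite /u mulrBr mulrA exprSr -(mulrA _ r (Num.sqrt 2)) r2 mulr1.
rewrite normrM ger0_norm ?exprn_ge0 ?(ltW r_gt0)//.
rewrite ler_wpM2l ?exprn_ge0 ?(ltW r_gt0)//.
have := s_pyth (2 ^ j * n)%N (2 ^ j * n)%N.
rewrite addnn -mul2n mulnA -expnS -mulr2n -[_ *+ 2]mulr_natl sqrtrM//.
by rewrite sqrtr_sqr (ger0_norm (s_ge0 _)).
Qed.

(** The correction [K * r ^+ j] decreases at each step by exactly the bound of [u_step], so the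
    corrected sequence is monotone; it is also nonnegative. *)
Let upper_cvg n : cvgn (fun j => u n j + K * r ^+ j).
Proof.
apply: nonincreasing_is_cvgn.
  apply/nonincreasing_seqP => j; rewrite -subr_ge0.
  rewrite [leRHS](_ : _ = (K - r * K) * r ^+ j - (u n j.+1 - u n j)).
    have := u_step n j; rewrite ler_norml => /andP[_].
    by rewrite KrB mulrAC -exprS subr_ge0.
  by rewrite exprS; ring.
exists 0 => _ [j _ <-].
by rewrite addr_ge0// mulr_ge0// exprn_ge0// ltW.
Qed.

Let geometric_cvg0 a : (fun j => a * r ^+ j) @ \oo --> (0 : R).
Proof.
rewrite -[0 in X in _ --> X](mulr0 a); apply: cvgZr.
by apply: cvg_expr; rewrite ger0_norm ?(ltW r_gt0).
Qed.

Let u_cvg n : cvgn (u n).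
Proof.
rewrite (_ : u n = (fun j => (u n j + K * r ^+ j) - K * r ^+ j)).
  by apply: is_cvgB; [exact: upper_cvg | apply: cvgP (geometric_cvg0 K)].
by apply/funext => j; rewrite addrK.
Qed.

(** The right-hand side is the sum of the first [j] errors of [u_step]. It stays below [K], so the
    bound survives the limit in [j]. *)
Let u_bound n j : `|u n j - s n| <= K * (1 - r ^+ j).
Proof.
elim: j => [|j ih].
  by rewrite /u expr0 mul1r expn0 mul1n !subrr normr0 mulr0.
rewrite (le_trans (ler_distD (u n j) _ _))//.
rewrite (le_trans (lerD (u_step _ _) ih))//.
rewrite le_eqVlt; apply/orP; left; apply/eqP.
rewrite [RHS](_ : _ = K * (1 - r ^+ j) + (K - r * K) * r ^+ j).
  by rewrite KrB exprS; ring.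
by rewrite exprS; ring.
Qed.

Let L n := limn (u n).

Let L_near n : `|L n - s n| <= K.
Proof.
have h : (fun j => `|u n j - s n|) @ \oo --> `|L n - s n|.
  by apply: cvg_norm; apply: cvgB; [exact: u_cvg | exact: cvg_cst].
rewrite -(cvg_lim _ h)//; apply: limr_le; first exact: cvgP h.
apply: nearW => j; apply: le_trans (u_bound n j) _.
by rewrite ler_piMr// gerBl exprn_ge0// ltW.
Qed.

Let L_ge0 k : 0 <= L k.
Proof.
apply: limr_ge; first exact: u_cvg.
by apply: nearW => j; rewrite mulr_ge0// exprn_ge0// ltW.
Qed.

Let L_pyth n m : L (n + m) ^+ 2 = L n ^+ 2 + L m ^+ 2.
Proof.
suff -> : L (n + m) = Num.sqrt (L n ^+ 2 + L m ^+ 2).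
  by rewrite sqr_sqrtr// addr_ge0// sqr_ge0.
apply/eqP; rewrite -subr_eq0 -normr_le0.
pose v j := `|u (n + m) j - Num.sqrt (u n j ^+ 2 + u m j ^+ 2)|.
have v_cvg : v @ \oo --> `|L (n + m) - Num.sqrt (L n ^+ 2 + L m ^+ 2)|.
  apply: cvg_norm; apply: cvgB; first exact: u_cvg.
  apply: continuous_cvg; first exact: sqrt_continuous.
  by apply: cvgD; rewrite expr2; apply: cvgM; exact: u_cvg.
rewrite -(cvg_lim _ v_cvg)// -(cvg_lim _ (geometric_cvg0 c))//.
apply: ler_lim; [exact: cvgP v_cvg | exact: cvgP (geometric_cvg0 c) |].
apply: nearW => j; rewrite /v /u mulnDr.
(* By homogeneity [r ^+ j] comes out of the square root, which leaves [s_pyth] at the dilated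
   indices. *)
rewrite !exprMn -mulrDr sqrtrM ?sqr_ge0// sqrtr_sqr.
have rj_ge0 : 0 <= r ^+ j by rewrite exprn_ge0// ltW.
rewrite (ger0_norm rj_ge0) -mulrBr normrM (ger0_norm rj_ge0) mulrC.
by rewrite ler_wpM2r.
Qed.

Lemma approximately_pythagorean_cvg :
  exists l : R, (fun n => n%:R^-1 * s n ^+ 2) @ \oo --> l.
Proof.
have L_sqr n : L n ^+ 2 = n%:R * L 1%N ^+ 2.
  elim: n => [|n ih].
    have /eqP := L_pyth 0 0; rewrite addn0 -subr_eq subrr mul0r.
    by move=> /eqP <-.
  by rewrite -addn1 L_pyth ih natrD mulrDl mul1r.
exists (L 1%N ^+ 2); rewrite -cvg_shiftS /=.
(* The square root of the quotient is squeezed first, within [K / sqrt (n + 1)] of [L 1], and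
   squared afterwards. Indices start at 1 to keep the divisor positive; [harmonic n] is
   [1 / (n + 1)]. *)
pose t n := (Num.sqrt n.+1%:R)^-1 * s n.+1.
have sqrt_harmonic0 : (fun n => K * Num.sqrt (@harmonic R n)) @ \oo --> (0 : R).
  rewrite -[0 in X in _ --> X](mulr0 K) -[X in K * X]sqrtr0; apply: cvgZr.
  by apply: continuous_cvg; [exact: sqrt_continuous | exact: cvg_harmonic].
have t_cvg : t @ \oo --> L 1%N.
  have lo : (fun n => L 1%N - K * Num.sqrt (@harmonic R n)) @ \oo --> L 1%N.
    by rewrite -[X in _ --> X]subr0; apply: cvgB => //; exact: cvg_cst.
  have hi : (fun n => L 1%N + K * Num.sqrt (@harmonic R n)) @ \oo --> L 1%N.
    by rewrite -[X in _ --> X]addr0; apply: cvgD => //; exact: cvg_cst.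
  apply: squeeze_cvgr lo hi; apply: nearW => n; rewrite -ler_distl.
  have sq_gt0 : 0 < Num.sqrt n.+1%:R :> R by rewrite sqrtr_gt0.
  have LE : L n.+1 = Num.sqrt n.+1%:R * L 1%N.
    rewrite -[LHS]ger0_norm// -[L 1%N]ger0_norm// -!sqrtr_sqr.
    by rewrite L_sqr sqrtrM.
  rewrite [X in `|X|](_ : _ = (Num.sqrt n.+1%:R)^-1 * (s n.+1 - L n.+1)).
    rewrite normrM gtr0_norm ?invr_gt0// mulrC distrC.
    by rewrite /harmonic sqrtrV// ler_wpM2r// ?invr_ge0 ?sqrtr_ge0.
  by rewrite LE mulrBr mulKf ?gt_eqF.
rewrite (_ : (fun n => _) = (fun n => t n * t n)).
  by rewrite expr2; exact: cvgM.
by apply/funext => n; rewrite -expr2 exprMn exprVn sqr_sqrtr.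
Qed.

End approximately_pythagorean.

(** * The standard deviation as a seminorm on square-integrable variables *)

Section second_moments.
Local Open Scope ereal_scope.
Context (d : measure_display) (T : measurableType d) (R : realType).
Context (P : probability T R).
Implicit Types X Y : T -> R.

Lemma sqr_expectation_Lfun2 X : measurable_fun setT X ->
  'E_P[fun w => (`|X w| ^+ 2)%R] < +oo -> X \in Lfun P 2%:E.
Proof.
move=> mX; rewrite unlock => X2; rewrite inE; apply/andP; split; rewrite inE//=.
rewrite /finite_norm unlock /Lnorm poweR_lty//.
by under eq_integral => w _ do rewrite /= powR_mulrn//.
Qed.

Lemma Lfun2_Lfun1 X : X \in Lfun P 2%:E -> X \in Lfun P 1.
Proof. by apply: Lfun_subset12; rewrite fin_num_measure. Qed.

Lemma Lfun2D X Y : X \in Lfun P 2%:E -> Y \in Lfun P 2%:E ->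
  (X \+ Y)%R \in Lfun P 2%:E.
Proof. by move=> X2 Y2; rewrite rpredD ?lee1n. Qed.

Lemma Lfun2B_cst X c : X \in Lfun P 2%:E -> (X \- cst c)%R \in Lfun P 2%:E.
Proof. by move=> X2; rewrite rpredB ?lee1n//= => _; rewrite Lfun_cst. Qed.

Definition sdev X : R := Num.sqrt (fine 'V_P[X]).

Lemma sdev_ge0 X : (0 <= sdev X)%R. Proof. exact: sqrtr_ge0. Qed.

Lemma sqr_sdev X : (sdev X ^+ 2)%R = fine 'V_P[X].
Proof. by rewrite sqr_sqrtr// fine_ge0// variance_ge0. Qed.

Lemma sdevN X : X \in Lfun P 2%:E -> sdev (\- X)%R = sdev X.
Proof. by move=> X2; rewrite /sdev varianceN. Qed.

(** After squaring, only the cross term differs, and Cauchy-Schwarz bounds the covariance. *)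
Lemma sdevD X Y : X \in Lfun P 2%:E -> Y \in Lfun P 2%:E ->
  (sdev (X \+ Y) <= sdev X + sdev Y)%R.
Proof.
move=> X2 Y2.
have vX := variance_fin_num X2; have vY := variance_fin_num Y2.
have cXY : covariance P X Y \is a fin_num.
  by rewrite covariance_fin_num ?Lfun2_mul_Lfun1 ?Lfun2_Lfun1.
have cov_le : (fine (covariance P X Y) <= sdev X * sdev Y)%R.
  have := covariance_le X2 Y2.
  rewrite -[X in sqrte X * _](fineK vX) -[X in _ * sqrte X](fineK vY).
  by rewrite -lee_fin (fineK cXY).
rewrite -ler_sqr ?nnegrE ?addr_ge0 ?sdev_ge0// sqr_sdev varianceD//.
rewrite fineD ?fin_numD ?vX ?vY ?fin_numM// fineD// fineM//= -!sqr_sdev.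
by rewrite sqrrD addrAC lerD2r lerD2l -[leRHS]mulr_natl ler_wpM2l.
Qed.

(** Reverse triangle inequality: the lower bound is [sdevD] applied to [X = (X + Y) + (- Y)]. *)
Lemma sdev_dist X Y : X \in Lfun P 2%:E -> Y \in Lfun P 2%:E ->
  (`|sdev (X \+ Y) - sdev X| <= sdev Y)%R.
Proof.
move=> X2 Y2; rewrite ler_norml lerBlDl sdevD// andbT lerNl opprB lerBlDl.
have XYK : (X \+ Y \+ \- Y)%R = X by apply/funext => w /=; rewrite addrK.
by rewrite -[in leLHS]XYK -(sdevN Y2) sdevD ?rpredN ?rpredD ?lee1n.
Qed.

Lemma sdev_le (tau : R) X : X \in Lfun P 2%:E ->
  'E_P[fun w => (`|X w| ^+ 2)%R] <= tau%:E -> (sdev X <= Num.sqrt tau)%R.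
Proof.
move=> X2 Xtau; apply: ler_wsqrtr; rewrite -lee_fin fineK ?variance_fin_num//.
apply: le_trans Xtau; rewrite varianceE//.
rewrite [X in 'E_P[X] - _](_ : _ = fun w => (`|X w| ^+ 2)%R); last first.
  by apply/funext => w; rewrite real_normK ?num_real.
rewrite leeBlDr ?leeDl ?sqre_ge0//.
by rewrite expe2 fin_numM// expectation_fin_num// Lfun2_Lfun1.
Qed.
End second_moments.

(** * The product space: shift invariance, and independence of past and future *)

Section sequence_space.
Context (d : measure_display) (G : measurableType d).

Lemma measurable_coord i : measurable_fun setT (@coord G i : Omega G -> G).
Proof.
by move=> _ A mA; apply: sub_sigma_algebra; exists i => //; exists A.
Qed.

Lemma measurable_to_sequence d' (T : measurableType d') (f : T -> Omega G) :
  (forall i, measurable_fun setT (fun x => coord i (f x))) ->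
  measurable_fun setT f.
Proof.
move=> mf; apply: (@measurability _ _ T (Omega G) _ _ (@cylinders _ G)) => //.
move=> _ [_ [i _ [A mA <-]] <-].
by rewrite !setTI -[X in measurable X]setTI; exact: mf.
Qed.

Lemma measurable_shift n :
  measurable_fun setT (@shift G n : Omega G -> Omega G).
Proof. by apply: measurable_to_sequence => i; exact: measurable_coord. Qed.

(** Plays the role of the isomorphism between [G^n * Omega] and [Omega], with no separate space of
    words: the tail of the first sequence is discarded. *)
Definition splice n (z : Omega G * Omega G) : Omega G :=
  fun k => if (k < n)%N then z.1 k else z.2 (k - n)%N.

Lemma measurable_splice n : measurable_fun setT (splice n).
Proof.
apply: measurable_to_sequence => i; rewrite /splice /coord.
case: (i < n)%N; apply: (measurableT_comp (measurable_coord _)).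
- exact: measurable_fst.
- exact: measurable_snd.
Qed.

Lemma shift_splice n z : shift n (splice n z) = z.2.
Proof. by apply/funext => k; rewrite /shift /splice ltnNge leq_addr addKn. Qed.

(** The sets that do not separate [w] from [w'] form a sigma-algebra containing the generators of
    F_n. *)
Lemma coord_filtration_congr n (B : set (Omega G)) (w w' : Omega G) :
  coord_filtration n B -> (forall i, (i < n)%N -> w i = w' i) ->
  B w -> B w'.
Proof.
move=> FB ww'.
suff: coord_filtration n `<=` [set C | C w <-> C w'] by move=> /(_ _ FB)[].
apply: smallest_sub; first split => /=.
- by [].
- by move=> A AP; split=> -[_ nA]; split=> // /AP.
- by move=> A AP; split=> -[i _ /AP ?]; exists i.
- move=> A; rewrite -bigcup_seq => -[i _ [D _ <-]].
  by rewrite setTI /coord /= ww'.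
Qed.

Definition cylinder n (A : nat -> set G) : set (Omega G) :=
  [set w | forall i, (i < n)%N -> A i (coord i w)].

Lemma measurable_cylinder n A : (forall i, measurable (A i)) ->
  measurable (cylinder n A).
Proof.
move=> mA; rewrite (_ : cylinder n A = \bigcap_(i < n) (coord i @^-1` A i)) //.
apply: fin_bigcap_measurable => [|i _]; first exact: finite_II.
by rewrite -[X in measurable X]setTI; exact: measurable_coord.
Qed.

Context (R : realType).

(** Uniqueness of finite measures on a generating pi-system, here the cylinders. *)
Lemma eq_measure_cylinder (m1 m2 : {measure set (Omega G) -> \bar R}) :
  (m1 setT < +oo)%E ->
  (forall n A, (forall i, measurable (A i)) ->
    m1 (cylinder n A) = m2 (cylinder n A)) ->
  forall B, measurable B -> m1 B = m2 B.
Proof.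
move=> m1oo m12.
pose C := [set B | exists n A,
  (forall i, measurable (A i)) /\ B = cylinder n A].
apply: (measure_unique C (fun=> setT)) => //.
- apply/seteqP; split.
    apply: sub_smallest2r; first exact: smallest_sigma_algebra.
    move=> _ [i _ [A mA <-]]; rewrite setTI.
    exists i.+1, (fun j => if j == i then A else setT).
    split; first by move=> j; case: ifP.
    apply/seteqP; split=> w /= => [wA j _|/(_ i (leqnn _))].
      by case: eqP => // ->.
    by rewrite eqxx.
  apply: smallest_sub; first exact: smallest_sigma_algebra.
  by move=> _ [n [A [mA ->]]]; exact: measurable_cylinder.
- move=> _ _ [n [A [mA ->]]] [m [B [mB ->]]].
  (* Both cylinders are padded with full sides up to the common length. *)
  exists (maxn n m), (fun i => (if (i < n)%N then A i else setT) `&`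
                            (if (i < m)%N then B i else setT)).
  split; first by move=> i; apply: measurableI; case: ifP.
  apply/seteqP; split=> w /=.
    by move=> [wA wB] i _; split; case: ifP => // h; auto.
  by move=> wAB; split=> i h; have := wAB i;
    rewrite h leq_max h ?orbT => /(_ isT)[].
- by move=> i; exists 0%N, (fun=> setT); split=> //; apply/seteqP; split.
- by apply/seteqP; split=> // w _; exists 0%N.
- by move=> _ [n [A [mA ->]]]; exact: m12.
Qed.

Context (mu : probability G R) (P : probability (Omega G) R).
Context (Pmu : is_product_measure mu P).

Let P1 : P setT = 1%E. Proof. exact: probability_setT. Qed.

(* This encodes the independence of the first [n] coordinates from the others,
   together with the stationarity of the coordinate process. *)
Lemma splice_preserves n B : measurable B ->
  (P \x P)%E (splice n @^-1` B) = P B.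
Proof.
move=> mB; apply/esym; move: B mB; have ms := measurable_splice n.
apply: (@eq_measure_cylinder P (pushforward (P \x P)%E (splice n))).
  by rewrite -ge0_fin_numE// fin_num_measure.
move=> m A mA; rewrite /= /pushforward.
(* A cylinder of length at most [n] constrains only the first sequence; a longer one pulls back to a
   product of cylinders of lengths [n] and [m - n]. *)
have [mn|/ltnW nm] := leqP m n.
  rewrite (_ : _ @^-1` _ = cylinder m A `*` setT).
    rewrite product_measure1E//; last exact: measurable_cylinder.
    by rewrite -[LHS]mule1; congr (_ * _)%E; exact/esym/P1.
  apply/seteqP; split=> -[x y] /=.
    move=> h; split=> // i im; have := h i im.
    by rewrite /coord /splice (leq_trans im mn).
  by move=> [h _] i im; rewrite /coord /splice (leq_trans im mn); exact: h.
rewrite -(subnKC nm); set k := (m - n)%N.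
rewrite (_ : _ @^-1` _ = cylinder n A `*` cylinder k (fun i => A (n + i)%N)).
  rewrite product_measure1E; try exact: measurable_cylinder.
  transitivity (\prod_(i < n + k) mu (A i))%E; first exact: Pmu.
  by rewrite big_split_ord; congr (_ * _)%E; apply/esym; exact: Pmu.
apply/seteqP; split=> -[x y] /=.
  move=> h; split=> i ik.
    by have := h i; rewrite /coord /splice ik; apply; exact: ltn_addr.
  have := h (n + i)%N; rewrite /coord /splice [(n + i < n)%N]ltnNge leq_addr.
  by rewrite addKn ltn_add2l; exact.
move=> [hx hy] i ik; rewrite /coord /splice; case: (ltnP i n) => ni.
  exact: hx.
by rewrite -[in A i](subnKC ni); apply: hy; rewrite ltn_subLR.
Qed.

(** Shifting a spliced sequence by [n] gives back the second component, whose law under [P \x P] is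
    [P]. *)
Lemma shift_preserves n (B : set (Omega G)) : measurable B ->
  P (shift n @^-1` B) = P B.
Proof.
move=> mB; rewrite -(splice_preserves n); last first.
  by rewrite -[X in measurable X]setTI; exact: measurable_shift.
rewrite (_ : _ @^-1` _ = setT `*` B).
  rewrite product_measure1E//.
  by rewrite -[RHS]mul1e; congr (_ * _)%E; exact: P1.
by apply/seteqP; split=> z /=; rewrite shift_splice// => -[].
Qed.

(** The nonnegative case comes first because [Lfun2_shift] draws from it the integrability that the
    signed case takes as input. *)
Lemma ge0_expectation_shift n (X : Omega G -> R) : measurable_fun setT X ->
  (forall w, 0 <= X w) -> ('E_P[X \o shift n] = 'E_P[X])%E.
Proof.
move=> mX X0; rewrite unlock; have ms := measurable_shift n.
transitivity (\int[pushforward P (shift n : Omega G -> Omega G)]_w (X w)%:E)%E.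
  rewrite ge0_integral_pushforward//; first exact/measurable_EFinP.
  by move=> w _; rewrite lee_fin.
by apply: eq_measure_integral => B mB _; exact: shift_preserves.
Qed.

Lemma Lfun2_shift n (X : Omega G -> R) : X \in Lfun P 2%:E ->
  X \o shift n \in Lfun P 2%:E.
Proof.
move=> X2; have mX : measurable_fun setT X.
  by move: X2 => /sub_Lfun_mfun; rewrite inE.
apply: sqr_expectation_Lfun2.
  exact: (measurableT_comp mX (measurable_shift n)).
rewrite (_ : (fun w => _) = (fun w => `|X w| ^+ 2) \o shift n)//.
rewrite ge0_expectation_shift//; last first.
  by apply: measurable_funX; exact: measurableT_comp.
have /Lfun2_integrable_sqr/integrableP[_] := X2.
rewrite unlock; apply: le_lt_trans; rewrite le_eqVlt; apply/orP; left.
apply/eqP; apply: eq_integral => w _ /=.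
by rewrite normrX.
Qed.

Lemma expectation_shift n (X : Omega G -> R) : X \in Lfun P 1 ->
  X \o shift n \in Lfun P 1 ->
  ('E_P[X \o shift n] = 'E_P[X])%E.
Proof.
move=> X1 Xs1; have mX : measurable_fun setT X.
  by move: X1 => /sub_Lfun_mfun; rewrite inE.
rewrite unlock; have ms := measurable_shift n.
transitivity (\int[pushforward P (shift n : Omega G -> Omega G)]_w (X w)%:E)%E.
  rewrite integral_pushforward//; first exact/measurable_EFinP.
  exact/Lfun1_integrable.
by apply: eq_measure_integral => B mB _; exact: shift_preserves.
Qed.

Lemma variance_shift n (X : Omega G -> R) : X \in Lfun P 2%:E ->
  ('V_P[X \o shift n] = 'V_P[X])%E.
Proof.
move=> X2; have Xs2 := Lfun2_shift n X2.
have mX : measurable_fun setT X by move: X2 => /sub_Lfun_mfun; rewrite inE.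
rewrite /variance unlock expectation_shift; try exact: Lfun2_Lfun1.
set c := fine _.
rewrite -(@ge0_expectation_shift n ((X \- cst c) * (X \- cst c)))//.
- by apply: measurable_funM; exact: measurable_funB.
- by move=> w; exact: sqr_ge0.
Qed.

(** Transported to [P \x P] by [splice n], the centred product becomes [X0 x * Y0 y], since [X] sees
    only the first [n] coordinates. By Fubini, the integral over [y] vanishes because [Y0] has mean
    0. *)
Lemma covariance_past_future n (X Y : Omega G -> R) :
  X \in Lfun P 2%:E -> Y \in Lfun P 2%:E ->
  (forall w w', (forall i, (i < n)%N -> w i = w' i) -> X w = X w') ->
  covariance P X (Y \o shift n) = 0%E.
Proof.
move=> X2 Y2 Xn; have Ys2 := Lfun2_shift n Y2.
have Y1 : Y \in Lfun P 1 by exact: Lfun2_Lfun1.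
rewrite unlock (expectation_shift Y1); last exact: Lfun2_Lfun1.
set a := fine 'E_P[X]%E; set b := fine 'E_P[Y]%E.
pose X0 : Omega G -> R := X \- cst a; pose Y0 : Omega G -> R := Y \- cst b.
have X02 : X0 \in Lfun P 2%:E by exact: Lfun2B_cst.
have Y02 : Y0 \in Lfun P 2%:E by exact: Lfun2B_cst.
have Y01 : P.-integrable setT (EFin \o Y0).
  exact/Lfun1_integrable/Lfun2_Lfun1.
have E_Y0 : (\int[P]_w (Y0 w)%:E = 0)%E.
  have := expectationB Y1 (Lfun_cst P b 1).
  have EY : ('E_P[Y] \is a fin_num)%E by exact: expectation_fin_num.
  by rewrite expectation_cst fineK// subee// unlock.
pose h : Omega G -> \bar R := EFin \o (X0 \* (Y0 \o shift n)).
have ih : P.-integrable setT h.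
  by apply/Lfun1_integrable/Lfun2_mul_Lfun1 => //; exact: Lfun2_shift.
have mh : measurable_fun setT h by exact: measurable_int ih.
have ms := measurable_splice n.
(* Fubini requires integrability on the product space, obtained by transporting the integral of
   [|h|]. *)
have ihs : (P \x P)%E.-integrable setT (h \o splice n).
  apply/integrableP; split; first exact: measurableT_comp.
  have /integrableP[_] := ih; apply: le_lt_trans.
  rewrite le_eqVlt; apply/orP; left; apply/eqP.
  transitivity (\int[pushforward (P \x P) (splice n)]_w `|h w|)%E.
    rewrite ge0_integral_pushforward//; exact: measurableT_comp.
  by apply: eq_measure_integral => B mB _; exact: splice_preserves.
transitivity (\int[P]_w h w)%E; first by rewrite unlock.
transitivity (\int[pushforward (P \x P) (splice n)]_w h w)%E.
  by apply: eq_measure_integral => B mB _; exact/esym/splice_preserves.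
rewrite integral_pushforward// -integral12_prod_meas1//.
apply: integral0_eq => x _.
transitivity (\int[P]_y ((X0 x)%:E * (Y0 y)%:E))%E.
  apply: eq_integral => y _; rewrite /h /= EFinM shift_splice /X0 /=.
  by rewrite (Xn _ x)// => i lt_in; rewrite /splice lt_in.
by rewrite integralZl// E_Y0 mule0.
Qed.

End sequence_space.

(** * Standard deviations of the cocycle *)

Section cocycle.
Context (R : realType) (d : measure_display) (G : measurableType d).
Context (mu : probability G R) (P : probability (Omega G) R).
Context (Q : nat -> Omega G -> R).
Context (Pmu : is_product_measure mu P).
Context (Qadapted : defective_adapted_cocycle Q).

Lemma cocycle_measurable n : measurable_fun setT (Q n).
Proof.
have [Q0 Qn] := Qadapted; case: n => [|n].
  by rewrite (_ : Q 0%N = cst 0)//; apply/funext.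
move=> _ B mB; rewrite setTI.
have : coord_filtration n.+1 (Q n.+1 @^-1` B) by exact: Qn.
apply: smallest_sub; first exact: smallest_sigma_algebra.
move=> A; rewrite -bigcup_seq => -[i _ [D mD <-]].
by apply: sub_sigma_algebra; exists i => //; exists D.
Qed.

(** The level set of [Q n] through [w] lies in F_n, so it also contains [w']. *)
Lemma cocycle_past n w w' : (forall i, (i < n)%N -> w i = w' i) ->
  Q n w = Q n w'.
Proof.
have [Q0 Qn] := Qadapted; case: n => [|n] ww'; first by rewrite !Q0.
apply/esym; have Qw := Qn n.+1 isT [set Q n.+1 w] (measurable_set1 _).
exact: (coord_filtration_congr Qw ww').
Qed.

Lemma defect_measurable n m : measurable_fun setT (defect Q n m).
Proof.
apply: measurable_funB.
  by apply: measurable_funB; exact: cocycle_measurable.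
exact: (measurableT_comp (cocycle_measurable m) (measurable_shift n)).
Qed.

Lemma cocycleD n m : Q (n + m)%N = (Q n \+ (Q m \o shift n)) \+ defect Q n m.
Proof.
apply/funext => w; rewrite /defect /=.
by rewrite -[Q (n + m)%N w - _ - _]addrA -opprD subrKC.
Qed.

Context (Q1_fin : finite_second_moment P Q) (tau2 : R).
Context (Qdev : forall n m,
  ('E_P[fun w => (`|defect Q n m w| ^+ 2)%R] <= tau2%:E)%E).

Lemma defect_Lfun2 n m : defect Q n m \in Lfun P 2%:E.
Proof.
apply: sqr_expectation_Lfun2; first exact: defect_measurable.
exact: le_lt_trans (Qdev n m) (ltry _).
Qed.

(** Induction on Q_{n+1} = Q_n + Q_1 \o theta_n + Psi_{n,1}, whose three terms are square
    integrable. *)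
Lemma cocycle_Lfun2 n : Q n \in Lfun P 2%:E.
Proof.
elim: n => [|n ih].
  have [Q0 _] := Qadapted.
  by rewrite (_ : Q 0%N = cst 0) ?Lfun_cst//; apply/funext.
have Q12 : Q 1%N \in Lfun P 2%:E.
  by apply: sqr_expectation_Lfun2 => //; exact: cocycle_measurable.
rewrite -addn1 cocycleD; apply: Lfun2D (defect_Lfun2 n 1).
by apply: Lfun2D => //; exact: (Lfun2_shift Pmu).
Qed.

Lemma sdev_cocycleD n m :
  `|sdev P (Q (n + m)%N) - Num.sqrt (sdev P (Q n) ^+ 2 + sdev P (Q m) ^+ 2)|
  <= Num.sqrt tau2.
Proof.
have Qs2 : Q m \o shift n \in Lfun P 2%:E.
  by apply: (Lfun2_shift Pmu); exact: cocycle_Lfun2.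
have Qn2 := cocycle_Lfun2 n.
(* Variances add since the covariance of past and future is 0; what then separates the two
   deviations is the defect. *)
have -> : Num.sqrt (sdev P (Q n) ^+ 2 + sdev P (Q m) ^+ 2) =
    sdev P (Q n \+ (Q m \o shift n)).
  rewrite {3}/sdev varianceD// (covariance_past_future Pmu) ?cocycle_Lfun2//.
    rewrite mule0 adde0 (variance_shift Pmu) ?cocycle_Lfun2//.
    by rewrite fineD ?variance_fin_num ?cocycle_Lfun2// !sqr_sdev.
  exact: cocycle_past.
rewrite cocycleD; apply: le_trans (sdev_le (defect_Lfun2 n m) (Qdev n m)).
by apply: sdev_dist; [exact: Lfun2D | exact: defect_Lfun2].
Qed.

End cocycle.

Unset Implicit Arguments.

Theorem theorem4p1 (R : realType) (d : measure_display) (G : measurableType d)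
    (mu : probability G R) (P : probability (Omega G) R)
    (Q : nat -> Omega G -> R) :
  is_product_measure mu P ->
  defective_adapted_cocycle Q ->
  finite_second_moment P Q ->
  second_moment_deviation P Q ->
  exists sigma2 : R,
    (fun n : nat => ((n%:R^-1)%:E * 'V_P[Q n])%E) @ \oo --> sigma2%:E.
Proof.
move=> Pmu Qadapted Q1_fin [tau2 Qdev].
have [l sl] := approximately_pythagorean_cvg (fun n => sdev_ge0 P (Q n))
  (sdev_cocycleD Pmu Qadapted Q1_fin Qdev).
exists l.
(* The variances are finite, so convergence in the extended reals reduces to that of the real
   sequence s_n^2 / n. *)
rewrite [X in X @ _](_ : _ =
  EFin \o (fun n => n%:R^-1 * sdev P (Q n) ^+ 2)).
  by apply: cvg_EFin; first exact: nearW.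
apply/funext => n /=; rewrite sqr_sdev EFinM fineK// variance_fin_num//.
exact: (cocycle_Lfun2 Pmu Qadapted Q1_fin Qdev).
Qed.
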